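(* Let $B$ be a bicategory. Then there exist a strictly associative bicategory $C$ and an equivalence $f: B \to C$.
   Context: Bicategories are the usual (weak) ones, with horizontal composite of 1-cells $a:x\to y$, $b:y\to z$ denoted $a\otimes b$, associators $\alpha_{a,b,c}:(a\otimes b)\otimes c\to a\otimes(b\otimes c)$ and unitors; a bicategory is strictly associative if its associators are vertical units (identities), so in particular $(a\otimes b)\otimes c=a\otimes(b\otimes c)$ (the unitors are not required to be identities). A functor of bicategories is a pseudofunctor (with invertible structural 2-cells $f(a)\otimes f(b)\to f(a\otimes b)$, $1_{f(x)}\to f(1_x)$). A functor $f:B\to C$ is an equivalence if there exist a functor $g:C\to B$ and pseudo-natural equivalences $\mathrm{id}_B\to gf$ and $\mathrm{id}_C\to fg$, where a pseudo-natural equivalence is a pseudo-natural transformation whose 1-cell components are equivalences. *)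

(* Defs.v *)
(** Bicategories in the plain type theory of Rocq: cells form types, equality
    of cells is Leibniz equality.  All composites are in diagrammatic order. *)

Declare Scope bicat_scope.
Delimit Scope bicat_scope with bicat.
Local Open Scope bicat_scope.

Record Category := {
  obj :> Type;
  mor : obj -> obj -> Type;
  idm : forall a, mor a a;
  comp : forall {a b c}, mor a b -> mor b c -> mor a c;
  comp_idl : forall a b (u : mor a b), comp (idm a) u = u;
  comp_idr : forall a b (u : mor a b), comp u (idm b) = u;
  comp_assoc : forall a b c d (u : mor a b) (v : mor b c) (w : mor c d),
    comp (comp u v) w = comp u (comp v w)
}.

Arguments mor {C} _ _ : rename.
Arguments idm {C} _ : rename.
Arguments comp {C a b c} _ _ : rename.
Arguments comp_idl {C a b} _ : rename.
Arguments comp_idr {C a b} _ : rename.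
Arguments comp_assoc {C a b c d} _ _ _ : rename.

Notation "u ;; v" := (comp u v)
  (at level 50, left associativity) : bicat_scope.

Record Iso {C : Category} (a b : C) := {
  iso_fwd :> mor a b;
  iso_bwd : mor b a;
  iso_fwd_bwd : iso_fwd ;; iso_bwd = idm a;
  iso_bwd_fwd : iso_bwd ;; iso_fwd = idm b
}.

Arguments iso_fwd {C a b} _.
Arguments iso_bwd {C a b} _.
Arguments iso_fwd_bwd {C a b} _.
Arguments iso_bwd_fwd {C a b} _.

Record Functor (C D : Category) := {
  fobj :> C -> D;
  fmor : forall {a b : C}, mor a b -> mor (fobj a) (fobj b);
  fmor_id : forall a : C, fmor (idm a) = idm (fobj a);
  fmor_comp : forall (a b c : C) (u : mor a b) (v : mor b c),
    fmor (u ;; v) = fmor u ;; fmor v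
}.

Arguments fobj {C D} _ _.
Arguments fmor {C D} _ {a b} _.
Arguments fmor_id {C D} _ _.
Arguments fmor_comp {C D} _ {a b c} _ _.

(** The objects of [hom x y] are the 1-cells from [x] to [y], its morphisms
    are the 2-cells, its composition is vertical composition.  The fields
    [tensor], [tensor2], [tensor2_id], [tensor2_comp] spell out a functor
    [hom x y * hom y z -> hom x z]. *)
Record Bicategory := {
  ob :> Type;
  hom : ob -> ob -> Category;
  one : forall x, hom x x;
  tensor : forall {x y z}, hom x y -> hom y z -> hom x z;
  tensor2 : forall {x y z} {a a' : hom x y} {b b' : hom y z},
    mor a a' -> mor b b' -> mor (tensor a b) (tensor a' b');
  tensor2_id : forall x y z (a : hom x y) (b : hom y z),
    tensor2 (idm a) (idm b) = idm (tensor a b);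
  tensor2_comp : forall x y z (a a' a'' : hom x y) (b b' b'' : hom y z)
      (u : mor a a') (u' : mor a' a'') (v : mor b b') (v' : mor b' b''),
    tensor2 (u ;; u') (v ;; v') = tensor2 u v ;; tensor2 u' v';
  assoc : forall {w x y z} (a : hom w x) (b : hom x y) (c : hom y z),
    Iso (tensor (tensor a b) c) (tensor a (tensor b c));
  assoc_nat : forall w x y z (a a' : hom w x) (b b' : hom x y) (c c' : hom y z)
      (u : mor a a') (v : mor b b') (t : mor c c'),
    tensor2 (tensor2 u v) t ;; assoc a' b' c'
    = assoc a b c ;; tensor2 u (tensor2 v t);
  lunit : forall {x y} (a : hom x y), Iso (tensor (one x) a) a;
  lunit_nat : forall x y (a a' : hom x y) (u : mor a a'),
    tensor2 (idm (one x)) u ;; lunit a' = lunit a ;; u;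
  runit : forall {x y} (a : hom x y), Iso (tensor a (one y)) a;
  runit_nat : forall x y (a a' : hom x y) (u : mor a a'),
    tensor2 u (idm (one y)) ;; runit a' = runit a ;; u;
  pentagon : forall v w x y z
      (a : hom v w) (b : hom w x) (c : hom x y) (d : hom y z),
    assoc (tensor a b) c d ;; assoc a b (tensor c d)
    = tensor2 (assoc a b c) (idm d) ;; assoc a (tensor b c) d
      ;; tensor2 (idm a) (assoc b c d);
  triangle : forall x y z (a : hom x y) (b : hom y z),
    assoc a (one y) b ;; tensor2 (idm a) (lunit b)
    = tensor2 (runit a) (idm b)
}.

Arguments hom {B} _ _ : rename.
Arguments one {B} _ : rename.
Arguments tensor {B x y z} _ _ : rename.
Arguments tensor2 {B x y z a a' b b'} _ _ : rename.
Arguments tensor2_id {B x y z} _ _ : rename.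
Arguments tensor2_comp {B x y z a a' a'' b b' b''} _ _ _ _ : rename.
Arguments assoc {B w x y z} _ _ _ : rename.
Arguments assoc_nat {B w x y z a a' b b' c c'} _ _ _ : rename.
Arguments lunit {B x y} _ : rename.
Arguments lunit_nat {B x y a a'} _ : rename.
Arguments runit {B x y} _ : rename.
Arguments runit_nat {B x y a a'} _ : rename.
Arguments pentagon {B v w x y z} _ _ _ _ : rename.
Arguments triangle {B x y z} _ _ : rename.

Notation "a ⊗ b" := (tensor a b)
  (at level 40, left associativity) : bicat_scope.
Notation "u ⊗2 v" := (tensor2 u v)
  (at level 40, left associativity) : bicat_scope.

Definition id_cast {C : Category} {a b : C} (e : a = b) : mor a b :=
  eq_rect a (mor a) (idm a) b e.

(** An associator can be compared with an identity 2-cell only along an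
    equality between its source and its target. *)
Definition strictly_associative (B : Bicategory) : Prop :=
  forall (w x y z : B) (a : hom w x) (b : hom x y) (c : hom y z),
  exists e : (a ⊗ b) ⊗ c = a ⊗ (b ⊗ c),
    iso_fwd (assoc a b c) = id_cast e.

Record Pseudofunctor (B C : Bicategory) := {
  pf0 :> B -> C;
  pf1 : forall {x y : B}, Functor (hom x y) (hom (pf0 x) (pf0 y));
  pf_tensor : forall {x y z : B} (a : hom x y) (b : hom y z),
    Iso (pf1 a ⊗ pf1 b) (pf1 (a ⊗ b));
  pf_one : forall x : B, Iso (one (pf0 x)) (pf1 (one x));
  pf_tensor_nat : forall (x y z : B) (a a' : hom x y) (b b' : hom y z)
      (u : mor a a') (v : mor b b'),
    (fmor pf1 u ⊗2 fmor pf1 v) ;; pf_tensor a' b'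
    = pf_tensor a b ;; fmor pf1 (u ⊗2 v);
  pf_assoc : forall (w x y z : B) (a : hom w x) (b : hom x y) (c : hom y z),
    (pf_tensor a b ⊗2 idm (pf1 c)) ;; pf_tensor (a ⊗ b) c
      ;; fmor pf1 (assoc a b c)
    = assoc (pf1 a) (pf1 b) (pf1 c) ;; (idm (pf1 a) ⊗2 pf_tensor b c)
      ;; pf_tensor a (b ⊗ c);
  pf_lunit : forall (x y : B) (a : hom x y),
    (pf_one x ⊗2 idm (pf1 a)) ;; pf_tensor (one x) a ;; fmor pf1 (lunit a)
    = lunit (pf1 a);
  pf_runit : forall (x y : B) (a : hom x y),
    (idm (pf1 a) ⊗2 pf_one y) ;; pf_tensor a (one y) ;; fmor pf1 (runit a)
    = runit (pf1 a)
}.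

Arguments pf0 {B C} _ _.
Arguments pf1 {B C} _ {x y}.
Arguments pf_tensor {B C} _ {x y z} _ _.
Arguments pf_one {B C} _ _.
Arguments pf_tensor_nat {B C} _ {x y z a a' b b'} _ _.
Arguments pf_assoc {B C} _ {w x y z} _ _ _.
Arguments pf_lunit {B C} _ {x y} _.
Arguments pf_runit {B C} _ {x y} _.

Definition id_iso {C : Category} (a : C) : Iso a a :=
  {| iso_fwd := idm a; iso_bwd := idm a;
     iso_fwd_bwd := comp_idl _; iso_bwd_fwd := comp_idl _ |}.

Definition comp_iso {C : Category} {a b c : C} (i : Iso a b) (j : Iso b c) :
  Iso a c.
Proof.
refine {| iso_fwd := iso_fwd i ;; iso_fwd j;
          iso_bwd := iso_bwd j ;; iso_bwd i |}.
- rewrite comp_assoc, <- (comp_assoc (iso_fwd j)), iso_fwd_bwd, comp_idl.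
  apply iso_fwd_bwd.
- rewrite comp_assoc, <- (comp_assoc (iso_bwd i)), iso_bwd_fwd, comp_idl.
  apply iso_bwd_fwd.
Defined.

Definition fmap_iso {C D : Category} (F : Functor C D) {a b : C}
  (i : Iso a b) : Iso (F a) (F b).
Proof.
refine {| iso_fwd := fmor F (iso_fwd i); iso_bwd := fmor F (iso_bwd i) |}.
- now rewrite <- fmor_comp, iso_fwd_bwd, fmor_id.
- now rewrite <- fmor_comp, iso_bwd_fwd, fmor_id.
Defined.

Definition id_functor (C : Category) : Functor C C :=
  {| fobj := fun a => a; fmor := fun _ _ u => u;
     fmor_id := fun _ => eq_refl; fmor_comp := fun _ _ _ _ _ => eq_refl |}.

Definition comp_functor {C D E : Category} (F : Functor C D) (G : Functor D E) :
  Functor C E.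
Proof.
refine {| fobj := fun a => G (F a); fmor := fun _ _ u => fmor G (fmor F u) |}.
- intros a. now rewrite !fmor_id.
- intros a b c u v. now rewrite !fmor_comp.
Defined.

Definition id_pseudofunctor (B : Bicategory) : Pseudofunctor B B.
Proof.
refine {| pf0 := fun x => x;
          pf1 := fun x y => id_functor (hom x y);
          pf_tensor := fun x y z a b => id_iso (a ⊗ b);
          pf_one := fun x => id_iso (one x) |}; cbn; intros.
- now rewrite comp_idl, comp_idr.
- now rewrite !tensor2_id, !comp_idl, !comp_idr.
- now rewrite !tensor2_id, !comp_idl.
- now rewrite !tensor2_id, !comp_idl.
Defined.

Lemma tensor2_compl {B : Bicategory} {x y z : B} {a a' a'' : hom x y}
  (b : hom y z) (u : mor a a') (u' : mor a' a'') :
  (u ;; u') ⊗2 idm b = (u ⊗2 idm b) ;; (u' ⊗2 idm b).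
Proof. now rewrite <- tensor2_comp, comp_idl. Qed.

Lemma tensor2_compr {B : Bicategory} {x y z : B} (a : hom x y)
  {b b' b'' : hom y z} (v : mor b b') (v' : mor b' b'') :
  idm a ⊗2 (v ;; v') = (idm a ⊗2 v) ;; (idm a ⊗2 v').
Proof. now rewrite <- tensor2_comp, comp_idl. Qed.

(** First [F], then [G]. *)
Definition comp_pseudofunctor {B C D : Bicategory}
  (F : Pseudofunctor B C) (G : Pseudofunctor C D) : Pseudofunctor B D.
Proof.
refine {| pf0 := fun x => G (F x);
          pf1 := fun x y => comp_functor (pf1 F) (pf1 G);
          pf_tensor := fun x y z a b =>
            comp_iso (pf_tensor G (pf1 F a) (pf1 F b))
                     (fmap_iso (pf1 G) (pf_tensor F a b));
          pf_one := fun x =>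
            comp_iso (pf_one G (F x)) (fmap_iso (pf1 G) (pf_one F x)) |};
  cbn; intros.
- rewrite <- comp_assoc, pf_tensor_nat, !comp_assoc, <- !fmor_comp.
  now rewrite pf_tensor_nat.
- rewrite tensor2_compl, tensor2_compr.
  rewrite <- (fmor_id (pf1 G) (pf1 F c)), <- (fmor_id (pf1 G) (pf1 F a)).
  transitivity
    ((pf_tensor G (pf1 F a) (pf1 F b) ⊗2 fmor (pf1 G) (idm (pf1 F c)))
     ;; pf_tensor G (pf1 F a ⊗ pf1 F b) (pf1 F c)
     ;; fmor (pf1 G) ((pf_tensor F a b ⊗2 idm (pf1 F c))
                      ;; pf_tensor F (a ⊗ b) c ;; fmor (pf1 F) (assoc a b c))).
  + rewrite !fmor_comp, <- !comp_assoc. do 2 f_equal.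
    rewrite !comp_assoc. f_equal. now rewrite pf_tensor_nat.
  + rewrite pf_assoc, !fmor_comp, !fmor_id, <- !comp_assoc, pf_assoc.
    f_equal. rewrite !comp_assoc. do 2 f_equal.
    now rewrite <- pf_tensor_nat, fmor_id.
- rewrite tensor2_compl, <- (pf_lunit G), <- (pf_lunit F), !fmor_comp.
  rewrite <- !comp_assoc. do 2 f_equal.
  rewrite !comp_assoc. f_equal.
  now rewrite <- pf_tensor_nat, fmor_id.
- rewrite tensor2_compr, <- (pf_runit G), <- (pf_runit F), !fmor_comp.
  rewrite <- !comp_assoc. do 2 f_equal.
  rewrite !comp_assoc. f_equal.
  now rewrite <- pf_tensor_nat, fmor_id.
Defined.

Record PseudoNat {B C : Bicategory} (F G : Pseudofunctor B C) := {
  pn0 : forall x : B, hom (F x) (G x);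
  pn1 : forall {x y : B} (a : hom x y),
    Iso (pf1 F a ⊗ pn0 y) (pn0 x ⊗ pf1 G a);
  pn_nat : forall (x y : B) (a a' : hom x y) (u : mor a a'),
    (fmor (pf1 F) u ⊗2 idm (pn0 y)) ;; pn1 a'
    = pn1 a ;; (idm (pn0 x) ⊗2 fmor (pf1 G) u);
  pn_tensor : forall (x y z : B) (a : hom x y) (b : hom y z),
    (pf_tensor F a b ⊗2 idm (pn0 z)) ;; pn1 (a ⊗ b)
    = assoc (pf1 F a) (pf1 F b) (pn0 z)
      ;; (idm (pf1 F a) ⊗2 pn1 b)
      ;; iso_bwd (assoc (pf1 F a) (pn0 y) (pf1 G b))
      ;; (pn1 a ⊗2 idm (pf1 G b))
      ;; assoc (pn0 x) (pf1 G a) (pf1 G b)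
      ;; (idm (pn0 x) ⊗2 pf_tensor G a b);
  pn_one : forall x : B,
    (pf_one F x ⊗2 idm (pn0 x)) ;; pn1 (one x)
    = lunit (pn0 x) ;; iso_bwd (runit (pn0 x))
      ;; (idm (pn0 x) ⊗2 pf_one G x)
}.

Arguments pn0 {B C F G} _ _.
Arguments pn1 {B C F G} _ {x y} _.
Arguments pn_nat {B C F G} _ {x y a a'} _.
Arguments pn_tensor {B C F G} _ {x y z} _ _.
Arguments pn_one {B C F G} _ _.

Definition is_equivalence1 {B : Bicategory} {x y : B} (a : hom x y) : Prop :=
  exists b : hom y x,
    inhabited (Iso (one x) (a ⊗ b)) /\ inhabited (Iso (b ⊗ a) (one y)).

Definition is_pseudonat_equivalence {B C : Bicategory}
  {F G : Pseudofunctor B C} (s : PseudoNat F G) : Prop :=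
  forall x : B, is_equivalence1 (pn0 s x).

Definition is_equivalence {B C : Bicategory} (f : Pseudofunctor B C) : Prop :=
  exists g : Pseudofunctor C B,
    (exists s : PseudoNat (id_pseudofunctor B) (comp_pseudofunctor f g),
        is_pseudonat_equivalence s) /\
    (exists t : PseudoNat (id_pseudofunctor C) (comp_pseudofunctor g f),
        is_pseudonat_equivalence t).

(* Main.v *)
Require Import Defs.

(** The bicategory [C] has the objects of [B], and its 1-cells are nonempty
    composable lists ([path]) of 1-cells of [B].  A path [p] has a value
    [eval p], its right-bracketed composite in [B], and the 2-cells from [p]
    to [q] are by decree the 2-cells of [B] from [eval p] to [eval q].  Paths
    compose by concatenation, and the bracketing isomorphisms
    [eval_concat p q : eval p ⊗ eval q -> eval (concat p q)], built from
    associators of [B], transport the remaining structure of [B] to [C]: each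
    operation or constraint of [C] is that of [B] conjugated by [eval_concat]
    ([path_bicategory]).  Each axiom of [C] then reduces to the same axiom of
    [B], because the conjugating isomorphisms cancel.

    Concatenation is associative, but along a provable equality only.  The
    content of strictness is that the conjugated associator is the cast along
    this equality.  This is a coherence statement, [eval_concat_assoc], proved
    by induction on the first path: the step is the pentagon together with
    the naturality of the associator.

    Sending a 1-cell to the one-entry path, and a path to its value, gives
    pseudofunctors [B -> C] and [C -> B] that are the identity on objects.
    Both round trips are the identity on objects and 2-cells, and change a
    1-cell only up to an isomorphism whose underlying 2-cell in [B] is an
    identity.  It remains to see such a family of isomorphisms as a
    pseudo-natural transformation with identity 1-cells as components.  Its
    2-cells [a ⊗ one y -> one x ⊗ a'] come from the unitors ([icon_cell]),
    and the two pseudo-naturality axioms rest on Kelly's consequences of the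
    pentagon and the triangle ([lunit_tensor], [runit_tensor],
    [lunit_one]).

    Paths are nonempty so that one-entry paths evaluate to their entry on the
    nose and so that [single (one x)] can serve as the unit: it makes
    [single] and [eval] preserve units strictly.  The unitors of [C] are then
    not identities. *)

Local Open Scope bicat_scope.

(** * Calculating with invertible 2-cells *)

Definition inv_iso {C : Category} {a b : C} (i : Iso a b) : Iso b a :=
  {| iso_fwd := iso_bwd i; iso_bwd := iso_fwd i;
     iso_fwd_bwd := iso_bwd_fwd i; iso_bwd_fwd := iso_fwd_bwd i |}.

(** Vertical composites are kept bracketed to the right.  The lemmas whose names
    end in [_comp] state a cancellation, a merge or an axiom followed by an
    arbitrary continuation, so that they rewrite in the middle of such a
    composite. *)
Lemma fwd_bwd_comp {C : Category} {a b c : C} (i : Iso a b) (u : mor a c) :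
  iso_fwd i ;; (iso_bwd i ;; u) = u.
Proof. now rewrite <- comp_assoc, iso_fwd_bwd, comp_idl. Qed.

Lemma bwd_fwd_comp {C : Category} {a b c : C} (i : Iso a b) (u : mor b c) :
  iso_bwd i ;; (iso_fwd i ;; u) = u.
Proof. now rewrite <- comp_assoc, iso_bwd_fwd, comp_idl. Qed.

Lemma iso_cancel_l {C : Category} {a b c : C} (i : Iso a b) (u v : mor b c) :
  iso_fwd i ;; u = iso_fwd i ;; v -> u = v.
Proof.
intros H. now rewrite <- (bwd_fwd_comp i u), H, bwd_fwd_comp.
Qed.

Lemma iso_cancel_r {C : Category} {a b c : C} (i : Iso b c) (u v : mor a b) :
  u ;; iso_fwd i = v ;; iso_fwd i -> u = v.
Proof.
intros H.
now rewrite <- (comp_idr u), <- (comp_idr v), <- (iso_fwd_bwd i),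
  <- !comp_assoc, H.
Qed.

Definition tensor_iso {B : Bicategory} {x y z : B} {a a' : hom x y}
  {b b' : hom y z} (i : Iso a a') (j : Iso b b') : Iso (a ⊗ b) (a' ⊗ b').
Proof.
refine {| iso_fwd := iso_fwd i ⊗2 iso_fwd j;
          iso_bwd := iso_bwd i ⊗2 iso_bwd j |}.
- now rewrite <- tensor2_comp, !iso_fwd_bwd, tensor2_id.
- now rewrite <- tensor2_comp, !iso_bwd_fwd, tensor2_id.
Defined.

Lemma tensor2_comp_comp {B : Bicategory} {x y z : B} {a a' a'' : hom x y}
  {b b' b'' : hom y z} {d : hom x z}
  (u : mor a a') (u' : mor a' a'') (v : mor b b') (v' : mor b' b'')
  (t : mor (a'' ⊗ b'') d) :
  (u ⊗2 v) ;; ((u' ⊗2 v') ;; t) = ((u ;; u') ⊗2 (v ;; v')) ;; t.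
Proof. now rewrite <- comp_assoc, <- tensor2_comp. Qed.

Lemma tensor2_split {B : Bicategory} {x y z : B} {a a' a'' : hom x y}
  {b b' : hom y z} (u : mor a a') (u' : mor a' a'') (v : mor b b') :
  (u ;; u') ⊗2 v = (u ⊗2 idm b) ;; (u' ⊗2 v).
Proof. now rewrite <- tensor2_comp, comp_idl. Qed.

Lemma assoc_nat_comp {B : Bicategory} {w x y z : B} {a a' : hom w x}
  {b b' : hom x y} {c c' : hom y z} {d : hom w z}
  (u : mor a a') (v : mor b b') (t : mor c c')
  (k : mor (a' ⊗ (b' ⊗ c')) d) :
  ((u ⊗2 v) ⊗2 t) ;; (assoc a' b' c' ;; k)
  = assoc a b c ;; ((u ⊗2 (v ⊗2 t)) ;; k).
Proof. now rewrite <- !comp_assoc, assoc_nat. Qed.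

Lemma pentagon_comp {B : Bicategory} {v w x y z : B} (a : hom v w)
  (b : hom w x) (c : hom x y) (d : hom y z) {e : hom v z}
  (u : mor (a ⊗ (b ⊗ (c ⊗ d))) e) :
  (assoc a b c ⊗2 idm d) ;; (assoc a (b ⊗ c) d
    ;; ((idm a ⊗2 assoc b c d) ;; u))
  = assoc (a ⊗ b) c d ;; (assoc a b (c ⊗ d) ;; u).
Proof. now rewrite <- !comp_assoc, <- pentagon, !comp_assoc. Qed.

(** * Kelly's unit coherence *)

Lemma one_tensor_faithful {B : Bicategory} {x y : B} {a b : hom x y}
  (u v : mor a b) : idm (one x) ⊗2 u = idm (one x) ⊗2 v -> u = v.
Proof.
intros H. apply (iso_cancel_l (lunit a)).
now rewrite <- !lunit_nat, H.
Qed.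

Lemma tensor_one_faithful {B : Bicategory} {x y : B} {a b : hom x y}
  (u v : mor a b) : u ⊗2 idm (one y) = v ⊗2 idm (one y) -> u = v.
Proof.
intros H. apply (iso_cancel_l (runit a)).
now rewrite <- !runit_nat, H.
Qed.

(** Whiskering with [one x] is faithful, so it suffices to prove the equation
    whiskered once on the left.  There the pentagon for [one x], [one x], [a],
    [b] and two triangles give it, up to an invertible composite of
    associators. *)
Lemma lunit_tensor {B : Bicategory} {x y z : B} (a : hom x y) (b : hom y z) :
  assoc (one x) a b ;; lunit (a ⊗ b) = lunit a ⊗2 idm b.
Proof.
apply one_tensor_faithful.
apply (iso_cancel_l (comp_iso
  (tensor_iso (assoc (one x) (one x) a) (id_iso b))
  (assoc (one x) (one x ⊗ a) b))); cbn.
rewrite tensor2_compr, <- comp_assoc, <- pentagon.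
rewrite !comp_assoc, triangle, <- assoc_nat.
rewrite <- (tensor2_id a b), <- assoc_nat.
now rewrite <- comp_assoc, <- tensor2_compl, triangle.
Qed.

(** The mirror image of [lunit_tensor], from the pentagon for [a], [b],
    [one z], [one z]. *)
Lemma runit_tensor {B : Bicategory} {x y z : B} (a : hom x y) (b : hom y z) :
  assoc a b (one z) ;; (idm a ⊗2 runit b) = runit (a ⊗ b).
Proof.
apply tensor_one_faithful.
apply (iso_cancel_r (assoc a b (one z))).
rewrite tensor2_compl, !comp_assoc, assoc_nat.
rewrite <- triangle, tensor2_compr, <- !comp_assoc, <- pentagon.
rewrite <- triangle, !comp_assoc, <- assoc_nat.
now rewrite tensor2_id.
Qed.

(** Whiskered on the right with [one x], the two sides become
    [assoc ;; lunit (one x ⊗ one x)] and [assoc ;; (idm ⊗2 lunit (one x))];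
    these agree because [lunit] is natural with respect to itself. *)
Lemma lunit_one {B : Bicategory} (x : B) :
  iso_fwd (lunit (one x)) = iso_fwd (runit (one x)).
Proof.
apply tensor_one_faithful.
rewrite <- lunit_tensor, <- triangle. f_equal.
apply (iso_cancel_r (lunit (one x))). symmetry. apply lunit_nat.
Qed.

(** * Pseudo-naturality squares over identity 1-cells *)

Lemma assoc_lunit_inv {B : Bicategory} {x y z : B} (a : hom x y)
  (b : hom y z) :
  (iso_bwd (lunit a) ⊗2 idm b) ;; assoc (one x) a b = iso_bwd (lunit (a ⊗ b)).
Proof.
apply (iso_cancel_r (lunit (a ⊗ b))).
rewrite comp_assoc, lunit_tensor, <- tensor2_compl, !iso_bwd_fwd.
apply tensor2_id.
Qed.

Lemma triangle_inv_comp {B : Bicategory} {x y z : B} {a : hom x y}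
  {b : hom y z} {c : hom x z} (u : mor (a ⊗ b) c) :
  (idm a ⊗2 iso_bwd (lunit b)) ;;
    (iso_bwd (assoc a (one y) b) ;; ((runit a ⊗2 idm b) ;; u)) = u.
Proof.
rewrite <- triangle, comp_assoc, bwd_fwd_comp, <- comp_assoc, <- tensor2_compr.
now rewrite iso_bwd_fwd, tensor2_id, comp_idl.
Qed.

Lemma lunit_inv_nat {B : Bicategory} {x y : B} {a a' : hom x y}
  (u : mor a a') :
  iso_bwd (lunit a) ;; (idm (one x) ⊗2 u) = u ;; iso_bwd (lunit a').
Proof.
apply (iso_cancel_r (lunit a')).
now rewrite !comp_assoc, lunit_nat, bwd_fwd_comp, iso_bwd_fwd, comp_idr.
Qed.

(** The naturality 2-cell at [a] of a transformation whose 1-cell components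
    are identities, made from a comparison [t] of the two images of [a].  Such
    transformations are Lack's icons; the next lemmas turn the evident axioms
    on the comparisons into the axioms of a pseudo-natural
    transformation. *)
Definition icon_cell {B : Bicategory} {x y : B} {a a' : hom x y}
  (t : Iso a a') : Iso (a ⊗ one y) (one x ⊗ a') :=
  comp_iso (runit a) (comp_iso t (inv_iso (lunit a'))).

Lemma icon_cell_nat {B : Bicategory} {x y : B} {a a' b b' : hom x y}
  (s : Iso a a') (t : Iso b b') (u : mor a b) (u' : mor a' b') :
  u ;; t = s ;; u' ->
  (u ⊗2 idm (one y)) ;; icon_cell t = icon_cell s ;; (idm (one x) ⊗2 u').
Proof.
intros H; cbn.
rewrite <- comp_assoc, runit_nat, !comp_assoc, lunit_inv_nat.
now rewrite <- (comp_assoc u), H, comp_assoc.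
Qed.

(** By naturality the left side is the icon cell of [r ⊗2 s] followed by [m'].
    On the right, [runit b] and [lunit a'] are absorbed into the unitors of
    the composites by Kelly's lemmas, and the unitors at the middle object [y]
    cancel by the triangle. *)
Lemma icon_cell_tensor {B : Bicategory} {x y z : B}
  {a a' : hom x y} {b b' : hom y z} {c c' : hom x z}
  (r : Iso a a') (s : Iso b b') (t : Iso c c')
  (m : mor (a ⊗ b) c) (m' : mor (a' ⊗ b') c') :
  m ;; t = (r ⊗2 s) ;; m' ->
  (m ⊗2 idm (one z)) ;; icon_cell t
  = assoc a b (one z) ;; (idm a ⊗2 icon_cell s)
    ;; iso_bwd (assoc a (one y) b') ;; (icon_cell r ⊗2 idm b')
    ;; assoc (one x) a' b' ;; (idm (one x) ⊗2 m').
Proof.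
intros H.
rewrite (icon_cell_nat (tensor_iso r s) t m m' H); cbn.
rewrite !tensor2_compl, !tensor2_compr, <- !(runit_tensor a b), !comp_assoc.
do 2 f_equal.
rewrite <- (comp_assoc _ (assoc _ _ _)), assoc_lunit_inv.
rewrite triangle_inv_comp, tensor2_comp_comp.
now rewrite comp_idl, comp_idr.
Qed.

Lemma icon_cell_one {B : Bicategory} {x : B} {c c' : hom x x}
  (t : Iso c c') (m : mor (one x) c) (m' : mor (one x) c') :
  m ;; t = m' ->
  (m ⊗2 idm (one x)) ;; icon_cell t
  = lunit (one x) ;; iso_bwd (runit (one x)) ;; (idm (one x) ⊗2 m').
Proof.
intros H.
rewrite (icon_cell_nat (id_iso (one x)) t m m').
- f_equal. cbn. rewrite comp_idl. apply (iso_cancel_r (lunit (one x))).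
  rewrite !comp_assoc, iso_bwd_fwd, comp_idr, lunit_one, iso_bwd_fwd.
  now rewrite comp_idr.
- cbn. now rewrite comp_idl.
Qed.

Lemma one_is_equivalence1 {B : Bicategory} (x : B) :
  is_equivalence1 (one x).
Proof.
exists (one x). split; constructor.
- exact (inv_iso (lunit (one x))).
- exact (lunit (one x)).
Qed.

(** * Paths of 1-cells *)

Inductive path {B : Bicategory} (x y : B) : Type :=
| single : hom x y -> path x y
| cons : forall w : B, hom x w -> path w y -> path x y.

Arguments single {B x y} _.
Arguments cons {B x y w} _ _.

Fixpoint eval {B : Bicategory} {x y : B} (p : path x y) : hom x y :=
  match p with
  | single a => a
  | cons a q => a ⊗ eval q
  end.

Fixpoint concat {B : Bicategory} {x y z : B} (p : path x y) :
  path y z -> path x z :=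
  match p with
  | single a => fun q => cons a q
  | cons a p' => fun q => cons a (concat p' q)
  end.

(** The rebracketing isomorphism: it moves the brackets of [eval p] to the right,
    one entry at a time. *)
Fixpoint eval_concat {B : Bicategory} {x y z : B} (p : path x y) :
  forall q : path y z, Iso (eval p ⊗ eval q) (eval (concat p q)) :=
  match p with
  | single a => fun q => id_iso (a ⊗ eval q)
  | cons a p' => fun q =>
      comp_iso (assoc a (eval p') (eval q))
               (tensor_iso (id_iso a) (eval_concat p' q))
  end.

Fixpoint concat_assoc {B : Bicategory} {w x y z : B} (p : path w x) :
  forall (q : path x y) (r : path y z),
  concat (concat p q) r = concat p (concat q r) :=
  match p with
  | single a => fun q r => eq_refl
  | cons a p' => fun q r => f_equal (cons a) (concat_assoc p' q r)
  end.

(** The category of 1-cells [x -> y] of the strictification: taking all 2-cells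
    between values as 2-cells makes [eval] fully faithful, so that every
    isomorphism of values is one of paths. *)
Definition path_category {B : Bicategory} (x y : B) : Category :=
  {| obj := path x y;
     mor := fun p q => mor (eval p) (eval q);
     idm := fun p => idm (eval p);
     comp := fun p q r u v => u ;; v;
     comp_idl := fun p q u => comp_idl u;
     comp_idr := fun p q u => comp_idr u;
     comp_assoc := fun p q r s u v t => comp_assoc u v t |}.

(** The conversion from 2-cells of [B] to 2-cells between paths, which are the
    same terms at two types; it fixes the type at which one is read. *)
Definition path_iso {B : Bicategory} {x y : B} (p q : path_category x y)
  (i : Iso (eval p) (eval q)) : Iso p q :=
  {| iso_fwd := iso_fwd i : mor p q; iso_bwd := iso_bwd i : mor q p;
     iso_fwd_bwd := iso_fwd_bwd i; iso_bwd_fwd := iso_bwd_fwd i |}.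

Definition path_tensor2 {B : Bicategory} {x y z : B} {p p' : path x y}
  {q q' : path y z} (u : mor (eval p) (eval p')) (v : mor (eval q) (eval q')) :
  mor (eval (concat p q)) (eval (concat p' q')) :=
  iso_bwd (eval_concat p q) ;; ((u ⊗2 v) ;; eval_concat p' q').

Definition path_assoc {B : Bicategory} {w x y z : B} (p : path w x)
  (q : path x y) (r : path y z) :
  Iso (eval (concat (concat p q) r)) (eval (concat p (concat q r))) :=
  comp_iso (inv_iso (eval_concat (concat p q) r))
  (comp_iso (tensor_iso (inv_iso (eval_concat p q)) (id_iso (eval r)))
  (comp_iso (assoc (eval p) (eval q) (eval r))
  (comp_iso (tensor_iso (id_iso (eval p)) (eval_concat q r))
            (eval_concat p (concat q r))))).

Definition path_lunit {B : Bicategory} {x y : B} (p : path x y) :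
  Iso (eval (concat (single (one x)) p)) (eval p) :=
  comp_iso (inv_iso (eval_concat (single (one x)) p)) (lunit (eval p)).

Definition path_runit {B : Bicategory} {x y : B} (p : path x y) :
  Iso (eval (concat p (single (one y)))) (eval p) :=
  comp_iso (inv_iso (eval_concat p (single (one y)))) (runit (eval p)).

(** * The bicategory of paths *)

Definition path_bicategory (B : Bicategory) : Bicategory.
Proof.
refine {| ob := B; hom := path_category;
  one := fun x => single (one x) : path_category x x;
  tensor := fun x y z p q => concat p q : path_category x z;
  tensor2 := fun x y z p p' q q' u v => path_tensor2 u v;
  assoc := fun w x y z p q r => path_iso (concat (concat p q) r)
    (concat p (concat q r)) (path_assoc p q r);
  lunit := fun x y p => path_iso (concat (single (one x)) p) p (path_lunit p);
  runit := fun x y p => path_iso (concat p (single (one y))) p (path_runit p)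
 |}; unfold path_tensor2; cbn -[eval_concat]; intros.
- now rewrite tensor2_id, comp_idl, iso_bwd_fwd.
- rewrite tensor2_comp, !comp_assoc. now rewrite fwd_bwd_comp.
- rewrite !comp_assoc, !fwd_bwd_comp. f_equal.
  rewrite !tensor2_comp_comp, !comp_idl, !comp_assoc, fwd_bwd_comp.
  rewrite iso_fwd_bwd, !comp_idr.
  now rewrite tensor2_split, comp_assoc, assoc_nat_comp, tensor2_comp_comp,
    comp_idr.
- rewrite !comp_assoc. f_equal. rewrite fwd_bwd_comp. apply lunit_nat.
- rewrite !comp_assoc. f_equal. rewrite fwd_bwd_comp. apply runit_nat.
(* Pentagon: what remains after cancelling the outer conjugations is moved
   past the associators by naturality. *)
- rewrite !comp_assoc, !fwd_bwd_comp. f_equal.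
  rewrite !tensor2_compl, !tensor2_compr, !comp_assoc. f_equal.
  rewrite (tensor2_comp_comp (eval_concat a (concat b c))).
  rewrite (tensor2_comp_comp _ _ (eval_concat (concat b c) d)).
  rewrite !iso_fwd_bwd, !comp_idl, !tensor2_id, !comp_idl.
  rewrite assoc_nat_comp.
  rewrite !(tensor2_comp_comp (idm (eval a)) (idm (eval a)) (eval_concat b c ⊗2 _)).
  rewrite <- tensor2_compl, iso_fwd_bwd, comp_idl, !tensor2_id, comp_idl.
  rewrite pentagon_comp, assoc_nat_comp. f_equal.
  rewrite <- (assoc_nat_comp (idm (eval a)) (idm (eval b))).
  now rewrite !tensor2_comp_comp, !tensor2_id, !comp_idl, !comp_idr.
- rewrite !comp_assoc, !fwd_bwd_comp, tensor2_comp_comp, fwd_bwd_comp, comp_idl.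
  now rewrite tensor2_compl, <- triangle, !comp_assoc.
Defined.

(** * Strictness *)

Definition path_cast {B : Bicategory} {x y : B} {p q : path x y} (e : p = q) :
  mor (eval p) (eval q) := id_cast (C := path_category x y) e.

Lemma path_cast_cons {B : Bicategory} {x y z : B} (a : hom x y)
  {p q : path y z} (e : p = q) :
  path_cast (f_equal (cons a) e) = idm a ⊗2 path_cast e.
Proof. destruct e. symmetry. apply tensor2_id. Qed.

(** Coherence of the rebracketing: the two ways of passing from
    [(eval p ⊗ eval q) ⊗ eval r] to the value of the threefold concatenation
    agree.  This pins down the transported associator as a cast. *)
Lemma eval_concat_assoc {B : Bicategory} {w x y z : B} (p : path w x) :
  forall (q : path x y) (r : path y z),
  (eval_concat p q ⊗2 idm (eval r))
    ;; (eval_concat (concat p q) r ;; path_cast (concat_assoc p q r))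
  = assoc (eval p) (eval q) (eval r)
    ;; ((idm (eval p) ⊗2 eval_concat q r) ;; eval_concat p (concat q r)).
Proof.
induction p as [w x a | w x v a p IH]; intros q r.
- cbn. now rewrite tensor2_id, comp_idl, !comp_idr.
- cbn. rewrite path_cast_cons, tensor2_compl, !comp_assoc, assoc_nat_comp.
  rewrite <- !tensor2_compr, IH, !tensor2_compr, pentagon_comp.
  now rewrite <- (tensor2_id a (eval p)), assoc_nat_comp.
Qed.

Lemma path_bicategory_strict (B : Bicategory) :
  strictly_associative (path_bicategory B).
Proof.
intros w x y z p q r. exists (concat_assoc p q r).
change (iso_fwd (path_assoc p q r) = path_cast (concat_assoc p q r)).
cbn. now rewrite <- eval_concat_assoc, tensor2_comp_comp, iso_bwd_fwd,
  comp_idl, tensor2_id, comp_idl, bwd_fwd_comp.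
Qed.

(** * The equivalence *)

Definition single_functor {B : Bicategory} (x y : B) :
  Functor (hom x y) (path_category x y) :=
  {| fobj := fun a : hom x y => single a : path_category x y;
     fmor := fun a b u => u;
     fmor_id := fun a => eq_refl;
     fmor_comp := fun a b c u v => eq_refl |}.

Definition eval_functor {B : Bicategory} (x y : B) :
  Functor (path_category x y) (hom x y) :=
  {| fobj := fun p : path_category x y => eval p;
     fmor := fun p q u => u;
     fmor_id := fun p => eq_refl;
     fmor_comp := fun p q r u v => eq_refl |}.

Definition single_pseudofunctor (B : Bicategory) :
  Pseudofunctor B (path_bicategory B).
Proof.
refine (Build_Pseudofunctor B (path_bicategory B) (fun x => x)
  single_functor
  (fun x y z a b =>
    path_iso (cons a (single b)) (single (a ⊗ b)) (id_iso (a ⊗ b)))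
  (fun x => path_iso (single (one x)) (single (one x)) (id_iso (one x)))
  _ _ _ _); intros; cbn; unfold path_tensor2; cbn.
- now rewrite !comp_idl, !comp_idr.
- now rewrite !tensor2_id, !comp_idl, !comp_idr.
- now rewrite !tensor2_id, !comp_idl.
- now rewrite !tensor2_id, !comp_idl.
Defined.

Definition eval_pseudofunctor (B : Bicategory) :
  Pseudofunctor (path_bicategory B) B.
Proof.
refine (Build_Pseudofunctor (path_bicategory B) B (fun x => x)
  (@eval_functor B)
  (fun x y z p q => eval_concat p q)
  (fun x => id_iso (@one B x))
  _ _ _ _); cbn -[eval_concat]; unfold path_tensor2; intros.
- now rewrite fwd_bwd_comp.
- rewrite !comp_assoc, fwd_bwd_comp, tensor2_comp_comp.
  now rewrite iso_fwd_bwd, comp_idl, tensor2_id, comp_idl.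
- now rewrite tensor2_id, comp_idl, fwd_bwd_comp.
- now rewrite tensor2_id, comp_idl, fwd_bwd_comp.
Defined.

(** Evaluating a one-entry path returns its entry, so the comparison is an
    identity. *)
Definition unit_transformation (B : Bicategory) :
  PseudoNat (id_pseudofunctor B)
    (comp_pseudofunctor (single_pseudofunctor B) (eval_pseudofunctor B)).
Proof.
refine (Build_PseudoNat _ _ (id_pseudofunctor B)
  (comp_pseudofunctor (single_pseudofunctor B) (eval_pseudofunctor B))
  (fun x => @one B x) (fun x y a => icon_cell (id_iso a)) _ _ _); intros.
- apply icon_cell_nat. cbn. now rewrite comp_idr, comp_idl.
- apply icon_cell_tensor. cbn. now rewrite tensor2_id, !comp_idl.
- apply icon_cell_one. cbn. now rewrite !comp_idl.
Defined.

(** A path and the one-entry path on its value differ as 1-cells but have the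
    same value; the identity 2-cell of this value is an isomorphism between
    them. *)
Definition counit_transformation (B : Bicategory) :
  PseudoNat (id_pseudofunctor (path_bicategory B))
    (comp_pseudofunctor (eval_pseudofunctor B) (single_pseudofunctor B)).
Proof.
refine (Build_PseudoNat _ _ (id_pseudofunctor (path_bicategory B))
  (comp_pseudofunctor (eval_pseudofunctor B) (single_pseudofunctor B))
  (fun x => @one (path_bicategory B) x)
  (fun x y p => icon_cell (B := path_bicategory B)
    (path_iso p (single (eval p)) (id_iso (eval p)))) _ _ _); intros.
- apply (icon_cell_nat (B := path_bicategory B)).
  cbn. now rewrite comp_idl, comp_idr.
- apply (icon_cell_tensor (B := path_bicategory B)).
  cbn. unfold path_tensor2; cbn.
    now rewrite tensor2_id, !comp_idl, comp_idr, iso_bwd_fwd.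
- apply (icon_cell_one (B := path_bicategory B)).
  cbn. now rewrite !comp_idl.
Defined.

Theorem corollary6p23 (B : Bicategory) :
  exists C : Bicategory,
    strictly_associative C /\
    exists f : Pseudofunctor B C, is_equivalence f.
Proof.
exists (path_bicategory B). split.
- apply path_bicategory_strict.
- exists (single_pseudofunctor B), (eval_pseudofunctor B). split.
  + exists (unit_transformation B). exact one_is_equivalence1.
  + exists (counit_transformation B). exact one_is_equivalence1.
Qed.
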